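(* Let $N\ge 1$, let $\mathcal S=\{s_1,\ldots,s_N\}$ be a family of nondegenerate intervals in $[-1,1]$, and let $\omega\in L^1(-1,1)$ satisfy $\omega(x)>0$ for almost every $x\in(-1,1)$. Let $\mathcal M:C([-1,1])\to\mathbb R$ be a linear functional. Then the degrees of freedom \[ \{\mathcal M,\mathcal D_1^\omega,\ldots,\mathcal D_N^\omega\} \] are unisolvent on $\Pi_N$ if and only if $\mathcal S$ is $\omega$-admissible and $\mathcal M(1)\neq 0$.
   Context: $\Pi_n$ is the space of real univariate polynomials of degree at most $n$. A nondegenerate interval is $s_i=[a_i,b_i]\subset[-1,1]$ with $a_i<b_i$. For $i=1,\ldots,N$ define \[ \mathcal D_i^\omega(f)=\int_{s_i}f'(x)\omega(x)\,dx\quad (f\in C^1([-1,1])),\qquad \mathcal H_i^\omega(g)=\int_{s_i}g(x)\omega(x)\,dx\quad (g\in C([-1,1])). \] The family $\mathcal S$ is called $\omega$-admissible if the linear map $\Pi_{N-1}\to\mathbb R^N$, $q\mapsto[\mathcal H_1^\omega(q),\ldots,\mathcal H_N^\omega(q)]^\top$, is an isomorphism. A set of $N+1$ linear functionals is unisolvent on $\Pi_N$ if the only $p\in\Pi_N$ annihilated by all of them is $p=0$ (equivalently, for arbitrary prescribed values of the functionals there is exactly one $p\in\Pi_N$ attaining them). *)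

(* Defs.v *)
From HB Require Import structures.
From mathcomp Require Export all_boot all_order all_algebra.
From mathcomp Require Export all_classical all_reals all_analysis.

Set Implicit Arguments.
Unset Strict Implicit.
Unset Printing Implicit Defensive.

Import Order.TTheory GRing.Theory Num.Theory.
Import numFieldNormedType.Exports.

Local Open Scope classical_set_scope.
Local Open Scope ring_scope.

Section ContinuousFunctions.
Context {T : topologicalType} {R : realType}.

Definition ctsfun : {pred T -> R^o} := fun f => `[< continuous f >].

Definition ctsfun_Sub (f : T -> R^o) (fP : f \in ctsfun) :
  continuousType T R^o := mkcts (asboolW fP).

Lemma ctsfun_rect (K : continuousType T R^o -> Type) :
  (forall f (fP : f \in ctsfun), K (ctsfun_Sub fP)) -> forall u, K u.
Proof.
move=> Ksub u; have uP : (u : T -> R^o) \in ctsfun.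
  by apply/asboolP; exact: cts_fun.
suff -> : u = ctsfun_Sub uP by exact: Ksub.
exact/continuousEP.
Qed.

Lemma ctsfun_SubK (f : T -> R^o) (fP : f \in ctsfun) :
  ctsfun_Sub fP = f :> (T -> R^o).
Proof. by []. Qed.

HB.instance Definition _ :=
  isSub.Build _ _ (continuousType T R^o) ctsfun_rect ctsfun_SubK.

Lemma ctsfun_submod_closed : submod_closed ctsfun.
Proof.
split=> [|c f g].
  by apply/asboolP => x; exact: cvg_cst.
move=> /asboolP cf /asboolP cg; apply/asboolP => x.
by apply: cvgD; [apply: cvgZr; exact: cf | exact: cg].
Qed.

HB.instance Definition _ :=
  GRing.isSubmodClosed.Build R (T -> R^o) ctsfun ctsfun_submod_closed.
HB.instance Definition _ :=
  [SubChoice_isSubLmodule of continuousType T R^o by <:].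

End ContinuousFunctions.

(* C([-1, 1]): continuous functions on the subtype [-1, 1], so that two of them
   are equal as soon as they agree on [-1, 1]; the real vector space structure
   is pointwise. *)
Definition C11 (R : realType) : lmodType R :=
  continuousType (set_type (`[(-1 : R), 1] : set R)) R^o.

Lemma restr_poly_continuous (R : realType) (p : {poly R}) :
  continuous ((fun x => p.[\val x]) : set_type (`[(-1 : R), 1] : set R) -> R^o).
Proof.
move=> x; apply: (@continuous_comp _ _ _ (@set_val _ _) (horner p)).
  exact: initial_continuous.
exact: continuous_horner.
Qed.

Definition restr_poly (R : realType) (p : {poly R}) : C11 R :=
  mkcts (@restr_poly_continuous R p).

Section Functionals.
Context {R : realType}.
Local Notation mu := (@lebesgue_measure R).

(* In momentH and momentD, functions on [-1, 1] are given by representatives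
   R -> R. For f of class C^1 on [-1, 1], the choice of representative affects
   f^`() on [-1, 1] at most at -1 and 1, hence not the integral. *)
Definition momentH (omega : R -> R) (a b : R) (g : R -> R) : R :=
  \int[mu]_(x in `[a, b]) (g x * omega x).

Definition momentD (omega : R -> R) (a b : R) (f : R -> R) : R :=
  \int[mu]_(x in `[a, b]) (f^`()%classic x * omega x).

(* {poly_n R} consists of the polynomials of size at most n, i.e. of degree at
   most n - 1: Pi_N is {poly_N.+1 R} and Pi_(N-1) is {poly_N R}. *)
Definition unisolvent (N : nat) (L : 'I_N.+1 -> {poly_(N.+1) R} -> R) : Prop :=
  forall p : {poly_(N.+1) R}, (forall j, L j p = 0) -> p = 0.

Definition moment_map (N : nat) (omega : R -> R) (a b : 'I_N -> R)
    (q : {poly_N R}) : 'cV[R]_N :=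
  \col_i momentH omega (a i) (b i) (horner q).

Definition admissible (N : nat) (omega : R -> R) (a b : 'I_N -> R) : Prop :=
  linear (moment_map omega a b) /\ bijective (moment_map omega a b).

(* Index 0 carries M, index i + 1 carries D_i. *)
Definition dofs (N : nat) (omega : R -> R) (a b : 'I_N -> R)
    (M : {scalar C11 R}) (j : 'I_N.+1) (p : {poly_(N.+1) R}) : R :=
  if unlift ord0 j is Some i then momentD omega (a i) (b i) (horner p)
  else M (restr_poly p).

End Functionals.

(* Main.v *)
(* Since D_i p = H_i p', the functionals D_i see p only up to a constant, and
   that constant is fixed by M exactly when M(1) <> 0. Hence the unisolvence of
   {M, D_1, ..., D_N} amounts to M(1) <> 0 together with the injectivity of the
   moment map on Pi_(N-1), which has the dimension of its codomain R^N. *)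
Require Import Defs.
From HB Require Import structures.
From mathcomp Require Import all_boot all_order all_algebra.
From mathcomp Require Import all_classical all_reals all_analysis.
Import Order.TTheory GRing.Theory Num.Theory.
Import numFieldNormedType.Exports.
Local Open Scope classical_set_scope.
Local Open Scope ring_scope.

(** A trivial kernel makes the image as large as the domain, hence all of [rT] when the dimensions
    agree. *)
Lemma linear_inj_bij (K : fieldType) (aT rT : vectType K)
    (f : {linear aT -> rT}) :
  \dim {:aT} = \dim {:rT} -> injective f -> bijective f.
Proof.
move=> dimE f_inj.
have fK : lker (linfun f) == 0%VS.
  by apply/lker0P => u v; rewrite !lfunE; exact: f_inj.
have fT : limg (linfun f) = fullv.
  apply/eqP; rewrite eqEdim subvf /= -dimE limg_dim_eq//.
  by rewrite (eqP fK) capv0.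
exists (linfun f)^-1%VF => u; first by rewrite -[f u]lfunE lker0_lfunK.
by rewrite -[LHS]lfunE limg_lfunVK// fT memvf.
Qed.

Section Antiderivative.
Context {R : numFieldType}.

(** The primitive without constant term: at [i = 0] the quotient is a division by zero, which is 0
    by convention. *)
Definition antideriv (q : {poly R}) : {poly R} :=
  \poly_(i < (size q).+1) (q`_i.-1 / i%:R).

Lemma size_antideriv (q : {poly R}) : (size (antideriv q) <= (size q).+1)%N.
Proof. exact: size_poly. Qed.

Lemma antiderivK (q : {poly R}) : (antideriv q)^`()%R = q.
Proof.
apply/polyP => i; rewrite coef_deriv coef_poly ltnS /=.
case: ltnP => [_|qi]; last by rewrite mul0rn nth_default.
by rewrite -[LHS]mulr_natr divfK// pnatr_eq0.
Qed.

(** In characteristic zero, a vanishing multiple [i.+1] of the coefficient of index [i.+1] forces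
    that coefficient to vanish. *)
Lemma deriv_eq0_polyC (p : {poly R}) : p^`()%R = 0 -> p = (p`_0)%:P.
Proof.
move=> p'0; apply/polyP => -[|i]; rewrite coefC//=.
have /eqP : p^`()%R`_i = 0 by rewrite p'0 coef0.
by rewrite coef_deriv mulrn_eq0 /= => /eqP.
Qed.

End Antiderivative.

Section Moments.
Context {R : realType} {omega : R -> R}.
Local Notation mu := (@lebesgue_measure R).
Hypothesis omega_L1 : mu.-integrable `]-1, 1[ (EFin \o omega).

Lemma bounded_horner (p : {poly R}) :
  [bounded p.[x] : R^o | x in `](-1 : R), 1[].
Proof.
(* The bound comes from the closed interval, where compactness is available. *)
have : compact ((horner p : R -> R^o) @` `[(-1 : R), 1]).
  apply: continuous_compact; last exact: segment_compact.
  by apply: continuous_subspaceT => x; exact: continuous_horner.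
move=> /compact_bounded [M [Mreal pM]]; exists M; split=> // y /pM My x /= x11.
by apply: My; exists x => //; exact: subset_itv_oo_cc.
Qed.

Lemma integrable_polyM (p : {poly R}) :
  mu.-integrable `]-1, 1[ (EFin \o (fun x => p.[x] * omega x)).
Proof.
apply: (@integrableMr _ _ _ mu `]-1, 1[ _ (horner p) (EFin \o omega)) => //.
  exact: measurable_poly.
exact: bounded_horner.
Qed.

Lemma integrable_polyM_oo {a b : R} (p : {poly R}) : -1 <= a -> b <= 1 ->
  mu.-integrable `]a, b[ (EFin \o (fun x => p.[x] * omega x)).
Proof.
move=> a_ge b_le; apply: integrableS (integrable_polyM p) => //.
by apply: subset_itv; rewrite bnd_simp.
Qed.

(* omega is only controlled on the open interval ]-1, 1[, and [a, b] may touch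
   its endpoints. *)
Lemma momentH_oo {a b : R} (p : {poly R}) : -1 <= a -> b <= 1 ->
  momentH omega a b (horner p) = \int[mu]_(x in `]a, b[) (p.[x] * omega x).
Proof.
move=> a_ge b_le; congr fine; apply: integral_itv_bndoo.
exact: measurable_int (integrable_polyM_oo p a_ge b_le).
Qed.

(** The integral is additive on integrable functions; the bounds on [a] and [b] give integrability
    on the open interval between them. *)
Lemma momentH_linear (a b c : R) (p q : {poly R}) :
  -1 <= a -> b <= 1 ->
  momentH omega a b (horner (c *: p + q)) =
    c * momentH omega a b (horner p) + momentH omega a b (horner q).
Proof.
move=> a_ge b_le; rewrite !momentH_oo//.
have pI := integrable_polyM_oo p a_ge b_le.
have qI := integrable_polyM_oo q a_ge b_le.
rewrite -RintegralZl// -RintegralD//; last first.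
  by under [X in _.-integrable _ X]eq_fun do rewrite /= EFinM; exact: integrableZl.
by apply: eq_Rintegral => x _; rewrite hornerD hornerZ mulrDl mulrA.
Qed.

(** The analytic derivative of a polynomial function is its formal derivative, so the rest of the
    argument can stay in [{poly R}]. *)
Lemma momentD_horner (a b : R) (p : {poly R}) :
  momentD omega a b (horner p) = momentH omega a b (horner p^`()%R).
Proof. by rewrite /momentD /momentH derivE. Qed.

End Moments.

Lemma restr_polyD (R : realType) (p q : {poly R}) :
  restr_poly (p + q) = restr_poly p + restr_poly q.
Proof. by apply: val_inj; apply/funext => x; rewrite [LHS]hornerD. Qed.

Lemma restr_polyZ (R : realType) (c : R) (p : {poly R}) :
  restr_poly (c *: p) = c *: restr_poly p.
Proof. by apply: val_inj; apply/funext => x; rewrite [LHS]hornerZ. Qed.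

Theorem theorem1 (R : realType) (N : nat) (N_ge1 : (1 <= N)%N)
    (a b : 'I_N -> R)
    (nondegenerate : forall i, [/\ -1 <= a i, a i < b i & b i <= 1])
    (omega : R -> R)
    (omega_L1 : (@lebesgue_measure R).-integrable `]-1, 1[ (EFin \o omega))
    (omega_gt0 : {ae @lebesgue_measure R,
                   forall x, x \in `]-1, 1[ -> 0 < omega x})
    (M : {scalar C11 R}) :
  unisolvent (dofs omega a b M) <->
  admissible omega a b /\ M (restr_poly 1) != 0.
Proof.
have H_linear : linear (moment_map omega a b).
  move=> c p q; apply/matrixP => i j; rewrite !mxE.
  by have [ai _ bi] := nondegenerate i; exact: momentH_linear.
pose H : {linear {poly_N R} -> 'cV[R]_N} :=
  HB.pack (moment_map omega a b)
    (GRing.isLinear.Build R {poly_N R} 'cV[R]_N _ _ H_linear).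
have dofs0 p : dofs omega a b M ord0 p = M (restr_poly p).
  by rewrite /dofs unlift_none.
have dofsS i p : dofs omega a b M (lift ord0 i) p =
    momentH omega (a i) (b i) (horner (val p)^`()%R).
  by rewrite /dofs liftK momentD_horner.
have MC c : M (restr_poly c%:P) = c * M (restr_poly 1).
  by rewrite -alg_polyC restr_polyZ linearZ.
split=> [uni|[[_ /bij_inj H_inj] M1_neq0] p dofs_p].
  have M1_neq0 : M (restr_poly 1) != 0.
    (* Otherwise the constant polynomial 1 would be annihilated by every functional, since its
       derivative is 0. *)
    apply/eqP => M1.
    have size1 : (size (1%R : {poly R}) <= N.+1)%N by rewrite size_poly1.
    suff /(congr1 val)/eqP/= : NPoly size1 = 0 by rewrite oner_eq0.
    apply: uni => j.
    case: (unliftP ord0 j) => [i ->|->]; last by rewrite dofs0.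
    rewrite dofsS /= derivC /momentH /Rintegral integral0_eq// => x _.
    by rewrite horner0 mul0r.
  split=> //; split=> //.
  apply: (@linear_inj_bij R {poly_N R} 'cV[R]_N H).
    by rewrite dim_polyn dimvf dim_matrix [RHS]muln1.
  apply: raddf_inj => q Hq.
  (* This constant is chosen so that [M] annihilates [antideriv q - c%:P]; subtracting it leaves the
     derivative [q], hence the moments, unchanged. *)
  pose c := M (restr_poly (antideriv q)) / M (restr_poly 1).
  have size_p : (size (antideriv q - c%:P)%R <= N.+1)%N.
    rewrite (leq_trans (size_polyD _ _))// geq_max size_polyN.
    apply/andP; split; first by rewrite (leq_trans (size_antideriv _))// ltnS.
    exact: leq_trans (size_polyC_leq1 _) _.
  have p' : (antideriv q - c%:P)^`()%R = q.
    by rewrite derivB derivC subr0 antiderivK.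
  have p0 : NPoly size_p = 0.
    apply: uni => j; case: (unliftP ord0 j) => [i ->|->].
      rewrite dofsS /= p'.
      by have /matrixP/(_ i 0) := Hq; rewrite !mxE.
    rewrite dofs0 /= restr_polyD -polyCN linearD MC.
    by rewrite mulNr divfK// subrr.
  (* As the derivative of a polynomial that unisolvence has shown to be zero, [q] is zero. *)
  apply: val_inj; rewrite /= -p'.
  by rewrite [antideriv q - c%:P](congr1 val p0) /= deriv0.
(* Conversely, the derivative of [p] lies in the domain of the moment map and has zero moments, so
   it vanishes by injectivity. *)
have p'_size : (size (val p)^`()%R <= N)%N.
  by rewrite (leq_trans (size_poly _ _))// -subn1 leq_subLR add1n size_npoly.
have p'0 : NPoly p'_size = 0.
  apply: H_inj; rewrite [RHS](raddf0 H); apply/matrixP => i j; rewrite !mxE -dofsS.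
  exact: dofs_p.
(* Only a constant is left, and [M] takes it to its product with the nonzero value at 1. *)
have pE := deriv_eq0_polyC _ (congr1 val p'0).
have := dofs_p ord0; rewrite dofs0 pE MC => /eqP.
rewrite mulf_eq0 (negPf M1_neq0) orbF => /eqP p00.
by apply: val_inj; rewrite pE p00.
Qed.
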